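(* Let $G_i$, $i \in [d]$, be graphs with $\mathrm{boxicity}(G_i) = b_i$ and $\mathrm{cubicity}(G_i) = c_i$. Then $$\max_{i\in[d]} b_i \;\leq\; \mathrm{boxicity}\left(\boxtimes_{i=1}^{d} G_i\right) \;\leq\; \sum_{i=1}^{d} b_i$$ and $$\max_{i\in[d]} c_i \;\leq\; \mathrm{cubicity}\left(\boxtimes_{i=1}^{d} G_i\right) \;\leq\; \sum_{i=1}^{d} c_i .$$ Furthermore, if each $G_i$, $i \in [d]$, has a universal vertex, then the second inequality in each of the two chains is an equality, i.e. $\mathrm{boxicity}(\boxtimes_{i=1}^{d} G_i) = \sum_{i=1}^{d} b_i$ and $\mathrm{cubicity}(\boxtimes_{i=1}^{d} G_i) = \sum_{i=1}^{d} c_i$.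
   Context: All graphs are finite, undirected and simple. $[d]=\{1,\ldots,d\}$. A $k$-box is a Cartesian product of $k$ closed intervals of $\mathbb{R}$ (a subset of $\mathbb{R}^k$), and a $k$-cube is a Cartesian product of $k$ closed intervals of unit length. A $k$-box ($k$-cube) representation of a graph $G$ is a function $f$ mapping each vertex to a $k$-box ($k$-cube) such that for any two distinct vertices $u,v$, $uv\in E(G)$ if and only if $f(u)\cap f(v)\neq\emptyset$. The boxicity (cubicity) of $G$ is the smallest natural number $k$ (with $0$ allowed; complete graphs have boxicity and cubicity $0$) such that $G$ has a $k$-box ($k$-cube) representation. The strong product $G_1\boxtimes G_2$ is the graph on $V(G_1)\times V(G_2)$ in which two distinct vertices $(u_1,u_2)$ and $(v_1,v_2)$ are adjacent if and only if ($u_1=v_1$ or $u_1v_1\in E(G_1)$) and ($u_2=v_2$ or $u_2v_2\in E(G_2)$); $\boxtimes_{i=1}^d G_i$ is the iterated strong product. A vertex is universal if it is adjacent to every other vertex of the graph. *)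

(* Defs.v *)
From mathcomp Require Import all_boot all_order all_algebra.
From mathcomp Require Import boolp classical_sets set_interval reals.
Set Implicit Arguments.
Unset Strict Implicit.
Unset Printing Implicit Defensive.
Import Order.TTheory GRing.Theory Num.Theory.

(* The vertex set may be empty; statements that need a vertex have to assume one. *)
Record sgraph := SGraph {
  vertex :> finType;
  adj : rel vertex;
  adj_sym : symmetric adj;
  adj_irrefl : irreflexive adj }.

Definition universal_vertex (G : sgraph) (u : G) : Prop :=
  forall v : G, v != u -> adj u v.

Section StrongProduct.
Variables G1 G2 : sgraph.

Definition strong_adj : rel (G1 * G2)%type := fun u v =>
  [&& u != v, (u.1 == v.1) || adj u.1 v.1 & (u.2 == v.2) || adj u.2 v.2].

Lemma strong_adj_sym : symmetric strong_adj.
Proof.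
move=> u v; rewrite /strong_adj eq_sym (eq_sym u.1) (eq_sym u.2).
by rewrite (adj_sym u.1) (adj_sym u.2).
Qed.

Lemma strong_adj_irrefl : irreflexive strong_adj.
Proof. by move=> u; rewrite /strong_adj eqxx. Qed.

Definition strong_product : sgraph :=
  SGraph strong_adj_sym strong_adj_irrefl.

End StrongProduct.

(* (...((G 0 [x] G 1) [x] G 2) ...) [x] G n, a product of n.+1 >= 1 factors. *)
Fixpoint strong_iprod (n : nat) : ('I_n.+1 -> sgraph) -> sgraph :=
  match n with
  | 0 => fun G => G ord0
  | m.+1 => fun G =>
      strong_product (strong_iprod (fun i : 'I_m.+1 => G (widen_ord (leqnSn _) i)))
                     (G ord_max)
  end.

Local Open Scope classical_set_scope.
Local Open Scope ring_scope.

Section Boxes.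
Variable R : realType.

Definition closed_interval (I : set R) : Prop :=
  exists a b : R, a <= b /\ I = `[a, b]%classic.

Definition unit_interval (I : set R) : Prop :=
  exists a : R, I = `[a, a + 1]%classic.

Definition cartesian (k : nat) (I : 'I_k -> set R) : set 'rV[R]_k :=
  [set x | forall j, I j (x ord0 j)].

Definition kbox (k : nat) (B : set 'rV[R]_k) : Prop :=
  exists I : 'I_k -> set R, (forall j, closed_interval (I j)) /\ B = cartesian I.

Definition kcube (k : nat) (B : set 'rV[R]_k) : Prop :=
  exists I : 'I_k -> set R, (forall j, unit_interval (I j)) /\ B = cartesian I.

Definition intersection_rep (G : sgraph) (k : nat) (f : G -> set 'rV[R]_k) : Prop :=
  forall u v : G, u != v -> (adj u v <-> f u `&` f v !=set0).

Definition has_box_rep (G : sgraph) (k : nat) : Prop :=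
  exists f : G -> set 'rV[R]_k, (forall v, kbox (f v)) /\ intersection_rep f.

Definition has_cube_rep (G : sgraph) (k : nat) : Prop :=
  exists f : G -> set 'rV[R]_k, (forall v, kcube (f v)) /\ intersection_rep f.

Lemma kcube_kbox (k : nat) (B : set 'rV[R]_k) : kcube B -> kbox B.
Proof.
move=> [I [hI ->]]; exists I; split=> // j.
by have [a ->] := hI j; exists a, (a + 1); rewrite lerDl ler01.
Qed.

(* One coordinate per vertex w: w is sent to [0, 1], its neighbours to [1, 2],
   and all other vertices to [2, 3]. *)
Lemma cube_rep_exists (G : sgraph) : exists k, `[< has_cube_rep G k >].
Proof.
exists #|G|; apply/asboolP.
pose lo (u w : G) : R := if u == w then 0 else if adj u w then 1 else 2.
pose I (u : G) (j : 'I_#|G|) : set R := `[lo u (enum_val j), lo u (enum_val j) + 1]%classic.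
exists (fun u => cartesian (I u)); split.
  by move=> v; exists (I v); split=> // j; exists (lo v (enum_val j)).
move=> u v uv; split=> [auv | [x [xu xv]]].
  exists (\row_j Num.max (lo u (enum_val j)) (lo v (enum_val j))).
  suff H w : `|lo u w - lo v w| <= 1.
    by split=> j; rewrite /I mxE /= in_itv /= le_max ge_max lexx ?orbT /=;
       have := H (enum_val j); rewrite ler_distl => /andP[h1 h2];
       rewrite lerDl ler01 /= ?andbT // -lerBlDr.
  rewrite /lo; have [uw|nuw] := eqVneq u w.
    by rewrite -uw [v == u]eq_sym (negPf uv) adj_sym auv sub0r normrN normr1.
  have [vw|nvw] := eqVneq v w; first by rewrite -vw auv subr0 normr1.
  have E : (2 - 1 : R) = 1 by rewrite -[2]/(1 + 1) addrK.
  by case: ifP; case: ifP; rewrite ?subrr ?normr0 ?ler01 // ?E ?normr1 //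
    distrC E normr1.
apply: contraT => nauv.
have := xu (enum_rank u); have := xv (enum_rank u).
rewrite /I enum_rankK /lo eqxx eq_sym (negPf uv) adj_sym (negPf nauv) /=.
rewrite !in_itv /= add0r => /andP[h _] /andP[_ h'].
by have := le_trans h h'; rewrite -subr_ge0 -[2]/(1 + 1) opprD addNKr oppr_ge0 ler10.
Qed.

Lemma box_rep_exists (G : sgraph) : exists k, `[< has_box_rep G k >].
Proof.
have [k /asboolP[f [hf fG]]] := cube_rep_exists G; exists k; apply/asboolP.
by exists f; split=> // v; apply: kcube_kbox.
Qed.

Definition boxicity (G : sgraph) : nat := ex_minn (box_rep_exists G).

Definition cubicity (G : sgraph) : nat := ex_minn (cube_rep_exists G).

End Boxes.

(* Main.v *)
Require Import Defs.
From mathcomp Require Import all_boot all_order all_algebra.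
From mathcomp Require Import boolp classical_sets set_interval reals.
Set Implicit Arguments.
Unset Strict Implicit.
Unset Printing Implicit Defensive.

(**
The upper bounds concatenate the coordinates of representations of the factors,
and the lower bounds hold because each factor is an induced subgraph of the
product. For the equalities, let u1 and u2 be universal in G1 and G2. In a
representation of the product every vertex of the copy G1 x {u2} meets every
vertex of the copy {u1} x G2. A coordinate separating a pair in each copy would
thus realise an induced 4-cycle by intervals, which is impossible. So the
coordinates separating some pair of the first copy represent G1, the other ones
represent G2, and the dimension of the product is at least the sum.
*)

Import Order.TTheory GRing.Theory Num.Theory.
Local Open Scope classical_set_scope.

(** The reflexive closure turns adjacency in a strong product into a plain conjunction over the
    factors, free of any distinctness condition. *)
Definition closed_adj (G : sgraph) (u v : G) : bool := (u == v) || adj u v.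

Lemma closed_adj_strong_product (G1 G2 : sgraph) (u v : strong_product G1 G2) :
  closed_adj u v = closed_adj u.1 v.1 && closed_adj u.2 v.2.
Proof.
rewrite /closed_adj /= /strong_adj.
by have [->|//] := eqVneq u v; rewrite !eqxx.
Qed.

Lemma closed_adj_universal (G : sgraph) (u v : G) :
  universal_vertex u -> closed_adj u v.
Proof.
move=> uG; rewrite /closed_adj; have [//|uv] := eqVneq u v.
by apply: uG; rewrite eq_sym.
Qed.

Lemma universal_vertex_strong_product (G1 G2 : sgraph) (u1 : G1) (u2 : G2) :
  universal_vertex u1 -> universal_vertex u2 ->
  universal_vertex (G := strong_product G1 G2) (u1, u2).
Proof.
move=> h1 h2 v vu; have := @closed_adj_strong_product G1 G2 (u1, u2) v.
rewrite (closed_adj_universal v.1 h1) (closed_adj_universal v.2 h2).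
by rewrite /closed_adj eq_sym (negPf vu).
Qed.

(** * Intervals and coordinatewise representations *)

Lemma closed_interval_nonempty (R : realType) (A : set R) :
  closed_interval A -> A !=set0.
Proof. by move=> [a [b [ab ->]]]; exists a; rewrite /= in_itv /= lexx. Qed.

(** If [A1] and [A2] were disjoint, [B1] and [B2], meeting both, would each contain the gap between
    them. This excludes an induced 4-cycle. *)
Lemma closed_interval_meet4 (R : realType) (A1 A2 B1 B2 : set R) :
    closed_interval A1 -> closed_interval A2 ->
    closed_interval B1 -> closed_interval B2 ->
    A1 `&` B1 !=set0 -> A1 `&` B2 !=set0 ->
    A2 `&` B1 !=set0 -> A2 `&` B2 !=set0 ->
  A1 `&` A2 !=set0 \/ B1 `&` B2 !=set0.
Proof.
have meetP (a b a' b' : R) : (a <= b -> a' <= b' ->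
    (`[a, b] `&` `[a', b'] !=set0) <-> (a <= b' /\ a' <= b))%R.
  move=> ab ab'; split=> [[x []]|[h h']].
    rewrite /= !in_itv /= => /andP[ax xb] /andP[ax' xb'].
    by split; [apply: le_trans xb' | apply: le_trans xb].
  exists (Num.max a a').
  by split; rewrite /= in_itv /= le_max ge_max lexx ?orbT /= ?ab ?ab' ?h ?h'.
move=> [a1 [a1' [le1 ->]]] [a2 [a2' [le2 ->]]].
move=> [b1 [b1' [le3 ->]]] [b2 [b2' [le4 ->]]].
rewrite !meetP // => -[h1 h2] [h3 h4] [h5 h6] [h7 h8].
(* If [a2' < a1], then [A2] lies left of [A1], and each left end of a [B] is at most [a2'], each
   right end at least [a1]. The other case is symmetric. *)
have [g1|g1] := leP a1 a2'; last first.
  by right; split; apply: le_trans (_ : (a1 <= _)%R) => //;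
     apply: le_trans (ltW g1).
have [g2|g2] := leP a2 a1'; first by left.
by right; split; apply: le_trans (_ : (a2 <= _)%R) => //;
   apply: le_trans (ltW g2).
Qed.

(* Taking P to be [closed_interval] or [unit_interval] gives box and cube
   representations; J indexes the coordinates. *)
Definition interval_rep (R : realType) (P : set R -> Prop) (G : sgraph)
    (J : finType) : Prop :=
  exists I : G -> J -> set R, (forall v j, P (I v j)) /\
    forall u v, closed_adj u v <-> forall j, I u j `&` I v j !=set0.

Lemma cartesian_meet (R : realType) (k : nat) (I I' : 'I_k -> set R) :
  cartesian I `&` cartesian I' !=set0 <-> forall j, I j `&` I' j !=set0.
Proof.
split=> [[x [xI xI']] j|/choice[f fI]].
  by exists (x ord0 j); split; [apply: xI | apply: xI'].
by exists (\row_j f j)%R; split=> j; rewrite mxE; have [] := fI j.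
Qed.

(** Boxes meet exactly when all their coordinates do. The diagonal pairs, which [intersection_rep]
    leaves out, are harmless because closed intervals are nonempty. *)
Lemma interval_repP (R : realType) (P : set R -> Prop) (G : sgraph) (k : nat) :
    (forall A, P A -> closed_interval A) ->
  (exists f : G -> set 'rV[R]_k,
     (forall v, exists I, (forall j, P (I j)) /\ f v = cartesian I) /\
     intersection_rep f) <-> interval_rep P G 'I_k.
Proof.
move=> Pclosed; split=> [[f [/choice[I fI] fG]]|[I [PI IG]]].
  exists I; split=> [v|u v]; first by have [] := fI v.
  have fE v' : f v' = cartesian (I v') by have [] := fI v'.
  rewrite /closed_adj; have [<-|uv] /= := eqVneq u v; last first.
    by rewrite -cartesian_meet -!fE; apply: fG.
  split=> // _ j; rewrite setIid; apply/closed_interval_nonempty/Pclosed.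
  by have [] := fI u.
exists (fun v => cartesian (I v)); split=> [v|u v uv].
  by exists (I v); split.
by rewrite cartesian_meet -IG /closed_adj (negPf uv).
Qed.

(** * Operations on interval representations *)

Lemma interval_rep_reindex (R : realType) (P : set R -> Prop) (G : sgraph)
    (J J' : finType) : #|J| = #|J'| ->
  interval_rep P G J -> interval_rep P G J'.
Proof.
move=> eqJ [I [PI IG]].
pose g (j : J') : J := enum_val (cast_ord (esym eqJ) (enum_rank j)).
pose h (j : J) : J' := enum_val (cast_ord eqJ (enum_rank j)).
have hK j : g (h j) = j by rewrite /g /h enum_valK cast_ordK enum_rankK.
exists (fun v j => I v (g j)); split=> // u v.
by rewrite IG; split=> m j //; rewrite -(hK j).
Qed.

Lemma interval_rep_ord (R : realType) (P : set R -> Prop) (G : sgraph)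
    (J : finType) : interval_rep P G J -> interval_rep P G 'I_#|J|.
Proof. by apply: interval_rep_reindex; rewrite card_ord. Qed.

Lemma interval_rep_strong_product (R : realType) (P : set R -> Prop)
    (G1 G2 : sgraph) (J1 J2 : finType) :
  interval_rep P G1 J1 -> interval_rep P G2 J2 ->
  interval_rep P (strong_product G1 G2) (J1 + J2)%type.
Proof.
move=> [I1 [PI1 IG1]] [I2 [PI2 IG2]].
exists (fun v j => match j with inl j1 => I1 v.1 j1 | inr j2 => I2 v.2 j2 end).
split=> [v [] //|u v]; rewrite closed_adj_strong_product.
split=> [/andP[/IG1 m1 /IG2 m2] [] //|m].
by apply/andP; split; [apply/IG1 => j; apply: (m (inl j))
                      |apply/IG2 => j; apply: (m (inr j))].
Qed.

Lemma interval_rep_induced (R : realType) (P : set R -> Prop) (G H : sgraph)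
    (J : finType) (h : H -> G) :
    (forall u v, closed_adj (h u) (h v) = closed_adj u v) ->
  interval_rep P G J -> interval_rep P H J.
Proof.
move=> hE [I [PI IG]]; exists (fun v => I (h v)); split=> // u v.
by rewrite -hE; apply: IG.
Qed.

(** Fixing a vertex of the other factor embeds each factor as an induced subgraph; hence nonempty
    factors in the lower bounds. *)
Lemma interval_rep_factors (R : realType) (P : set R -> Prop)
    (G1 G2 : sgraph) (J : finType) (u1 : G1) (u2 : G2) :
  interval_rep P (strong_product G1 G2) J ->
  interval_rep P G1 J /\ interval_rep P G2 J.
Proof.
move=> rep; split.
  apply: (interval_rep_induced (h := fun x : G1 => (x, u2) : strong_product G1 G2)) rep => x y.
  by rewrite closed_adj_strong_product /= {2}/closed_adj eqxx andbT.
apply: (interval_rep_induced (h := fun x : G2 => (u1, x) : strong_product G1 G2)) rep => x y.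
by rewrite closed_adj_strong_product /= {1}/closed_adj eqxx.
Qed.

Lemma interval_rep_split (R : realType) (P : set R -> Prop)
    (G1 G2 : sgraph) (J : finType) (u1 : G1) (u2 : G2) :
    (forall A, P A -> closed_interval A) ->
    universal_vertex u1 -> universal_vertex u2 ->
    interval_rep P (strong_product G1 G2) J ->
  exists p : pred J, interval_rep P G1 {j | p j} /\
                     interval_rep P G2 {j | predC p j}.
Proof.
move=> Pclosed uG1 uG2 [I [PI IG]].
(* The coordinates that separate some pair in the copy of [G1] at [u2]. *)
pose p : pred J := fun j =>
  `[< exists x y : G1, ~ (I (x, u2) j `&` I (y, u2) j !=set0) >].
have symC : symmetric (@closed_adj G1).
  by move=> x y; rewrite /closed_adj eq_sym (adj_sym x).
have cross x x' j : I (x, u2) j `&` I (u1, x') j !=set0.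
  move: j; apply/IG; rewrite closed_adj_strong_product /=.
  by rewrite symC !closed_adj_universal.
exists p; split.
  exists (fun x j => I (x, u2) (val j)); split=> // x y.
  have -> : closed_adj x y =
      closed_adj (G := strong_product G1 G2) (x, u2) (y, u2).
    by rewrite closed_adj_strong_product /= {3}/closed_adj eqxx andbT.
  (* A coordinate outside [p] separates no pair of this copy, so dropping it loses nothing. *)
  rewrite IG; split=> m j; first exact: m.
  have [pj|/asboolPn npj] := boolP (p j); first exact: (m (exist _ j pj)).
  by apply: contrapT => nm; apply: npj; exists x, y.
exists (fun x j => I (u1, x) (val j)); split=> // x y.
have -> : closed_adj x y =
    closed_adj (G := strong_product G1 G2) (u1, x) (u1, y).
  by rewrite closed_adj_strong_product /= {2}/closed_adj eqxx.
rewrite IG; split=> m j; first exact: m.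
(* At a coordinate in [p], the disjoint intervals of [z] and [t] both meet those of [x] and [y] by
   [cross], which forces the latter two to meet. *)
have [/asboolP[z [t nzt]]|npj] := boolP (p j); last exact: (m (exist _ j npj)).
have Iclosed v : closed_interval (I v j) by apply/Pclosed/PI.
by have [] := closed_interval_meet4 (Iclosed (z, u2)) (Iclosed (t, u2))
  (Iclosed (u1, x)) (Iclosed (u1, y)) (cross _ _ _) (cross _ _ _)
  (cross _ _ _) (cross _ _ _).
Qed.

(** * Iterated products, by induction on the number of factors *)

Lemma card_strong_iprod_gt0 (n : nat) (G : 'I_n.+1 -> sgraph) :
  (forall i, 0 < #|G i|) -> 0 < #|strong_iprod G|.
Proof.
elim: n G => [|n IHn] G G0 /=; first exact: G0.
by rewrite card_prod muln_gt0 G0 IHn.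
Qed.

Lemma universal_vertex_strong_iprod (n : nat) (G : 'I_n.+1 -> sgraph) :
    (forall i, exists u : G i, universal_vertex u) ->
  exists u : strong_iprod G, universal_vertex u.
Proof.
elim: n G => [|n IHn] G uG /=; first exact: uG.
have [u hu] := IHn _ (fun i => uG (widen_ord (leqnSn _) i)).
have [v hv] := uG ord_max.
by exists (u, v); apply: universal_vertex_strong_product.
Qed.

(** Common abstraction of boxicity and cubicity, so that each inequality is proved once for both. *)
Definition interval_dimension (R : realType) (P : set R -> Prop)
    (d : sgraph -> nat) : Prop :=
  forall G, interval_rep P G 'I_(d G) /\
    forall k, interval_rep P G 'I_k -> d G <= k.

Lemma interval_dimension_bounds (R : realType) (P : set R -> Prop)
    (d : sgraph -> nat) (n : nat) (G : 'I_n.+1 -> sgraph) :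
    interval_dimension P d -> (forall i, 0 < #|G i|) ->
  \max_(i < n.+1) d (G i) <= d (strong_iprod G) <= \sum_(i < n.+1) d (G i).
Proof.
move=> dP; elim: n G => [|n IHn] G G0 /=.
  rewrite !big_ord_recr !big_ord0 /= max0n add0n.
  by rewrite (_ : ord_max = ord0) ?leqnn //; apply: val_inj.
set H := strong_iprod _.
have H0 : forall i : 'I_n.+1, 0 < #|G (widen_ord (leqnSn n.+1) i)| by [].
have /andP[lo up] : _ <= d H <= _ := IHn _ H0.
have /card_gt0P[u _] : 0 < #|H| := card_strong_iprod_gt0 H0.
have /card_gt0P[v _] := G0 ord_max.
rewrite big_ord_recr [X in _ <= _ <= X]big_ord_recr /= geq_max.
have [repHG minHG] := dP (strong_product H (G ord_max)).
have [r1 r2] := interval_rep_factors u v repHG.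
rewrite (proj2 (dP _) _ r2) (leq_trans lo (proj2 (dP _) _ r1)) /=.
apply: leq_trans (leq_add up (leqnn _)); apply: minHG.
have := interval_rep_strong_product (proj1 (dP H))
  (proj1 (dP (G ord_max))).
by apply: interval_rep_reindex; rewrite card_sum !card_ord.
Qed.

Lemma interval_dimension_universal (R : realType) (P : set R -> Prop)
    (d : sgraph -> nat) (n : nat) (G : 'I_n.+1 -> sgraph) :
    (forall A, P A -> closed_interval A) -> interval_dimension P d ->
    (forall i, exists u : G i, universal_vertex u) ->
  \sum_(i < n.+1) d (G i) <= d (strong_iprod G).
Proof.
move=> Pclosed dP; elim: n G => [|n IHn] G uG.
  rewrite big_ord_recr big_ord0 /= add0n.
  by rewrite (_ : ord_max = ord0) //; apply: val_inj.
rewrite big_ord_recr /=; set H := strong_iprod _.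
have uG' := fun i : 'I_n.+1 => uG (widen_ord (leqnSn n.+1) i).
have [u hu] : exists u : H, universal_vertex u.
  exact: universal_vertex_strong_iprod uG'.
have [v hv] := uG ord_max.
apply: leq_trans (leq_add (IHn _ uG') (leqnn _)) _.
have [repHG _] := dP (strong_product H (G ord_max)).
have [p [r1 r2]] := interval_rep_split Pclosed hu hv repHG.
(* The predicate [p] partitions the coordinates of the product, and each class bounds the dimension
   of one factor. *)
rewrite -[X in _ <= X]card_ord -(cardC p).
rewrite -(card_sig p) -(card_sig (predC p)).
by apply: leq_add; apply: (proj2 (dP _)); apply: interval_rep_ord.
Qed.

(** * Specialisation to boxicity and cubicity *)

Lemma unit_interval_closed (R : realType) (A : set R) :
  unit_interval A -> closed_interval A.
Proof. by move=> [a ->]; exists a, (a + 1)%R; rewrite lerDl ler01. Qed.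

Lemma boxicity_dimension (R : realType) :
  interval_dimension (@closed_interval R) (boxicity R).
Proof.
move=> G; rewrite /boxicity; case: ex_minnP => m /asboolP rep mmin.
have repP k := @interval_repP R (@closed_interval R) G k (fun=> id).
by split=> [|k /repP repk]; [apply/repP | apply/mmin/asboolP].
Qed.

Lemma cubicity_dimension (R : realType) :
  interval_dimension (@unit_interval R) (cubicity R).
Proof.
move=> G; rewrite /cubicity; case: ex_minnP => m /asboolP rep mmin.
have repP k := @interval_repP R (@unit_interval R) G k (@unit_interval_closed R).
by split=> [|k /repP repk]; [apply/repP | apply/mmin/asboolP].
Qed.

Local Close Scope classical_set_scope.

Theorem theorem1 (R : realType) (n : nat) (G : 'I_n.+1 -> sgraph)
  (b c : 'I_n.+1 -> nat)
  (G_nonempty : forall i, 0 < #|G i|)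
  (boxG : forall i, boxicity R (G i) = b i)
  (cubG : forall i, cubicity R (G i) = c i) :
  [/\ \max_(i < n.+1) b i <= boxicity R (strong_iprod G) <= \sum_(i < n.+1) b i,
      \max_(i < n.+1) c i <= cubicity R (strong_iprod G) <= \sum_(i < n.+1) c i
    & (forall i, exists u : G i, universal_vertex u) ->
      boxicity R (strong_iprod G) = \sum_(i < n.+1) b i /\
      cubicity R (strong_iprod G) = \sum_(i < n.+1) c i].
Proof.
have <- : boxicity R \o G = b by apply: funext.
have <- : cubicity R \o G = c by apply: funext.
have dbox := boxicity_dimension R; have dcub := cubicity_dimension R.
have bbox := interval_dimension_bounds dbox G_nonempty.
have bcub := interval_dimension_bounds dcub G_nonempty.
split=> // uG; split; apply/eqP; rewrite eqn_leq.
  have /andP[_ ->] := bbox.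
  exact: interval_dimension_universal (fun=> id) dbox uG.
have /andP[_ ->] := bcub.
exact: interval_dimension_universal (@unit_interval_closed R) dcub uG.
Qed.
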